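(* Let $F$ be a field and let $n \ge 1$ be an integer. Then the double Capelli polynomial $h_{4n-2}$ is a polynomial identity for every proper $F$-subalgebra $A$ of the matrix algebra $M_n(F)$; that is, $h_{4n-2}(a_1,\dots,a_{2n-1},b_1,\dots,b_{2n-1})=0$ for all $a_1,\dots,a_{2n-1},b_1,\dots,b_{2n-1}\in A$.
   Context: $M_n(F)$ is the $F$-algebra of $n\times n$ matrices over $F$. For an integer $t\ge 1$, the double Capelli polynomial of total degree $2t$ is the element of the free associative $F$-algebra in noncommuting variables given by $$h_{2t}(x_1,\dots,x_t,y_1,\dots,y_t)=\sum_{\sigma,\tau\in S_t}(\mathrm{sg}\,\sigma\tau)\,x_{\sigma(1)}y_{\tau(1)}x_{\sigma(2)}y_{\tau(2)}\cdots x_{\sigma(t)}y_{\tau(t)},$$ where $S_t$ is the symmetric group on $\{1,\dots,t\}$ and $\mathrm{sg}\,\sigma\tau$ is the product of the signs of $\sigma$ and $\tau$. Thus $h_{4n-2}$ is the case $t=2n-1$. A nonzero polynomial in noncommuting variables is a polynomial identity for an $F$-algebra $R$ if it vanishes under every substitution of elements of $R$ for its variables. *)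

(* Defs.v *)
From HB Require Import structures.
From mathcomp Require Import all_boot all_fingroup all_algebra all_field.
From mathcomp.multinomials Require Import monalg.

Set Implicit Arguments.
Unset Strict Implicit.
Unset Printing Implicit Defensive.

Import GRing.Theory.
Local Open Scope ring_scope.

(* {fmonom X} is the free monoid of words over X, so the monoid algebra below *)
(* is the free associative F-algebra F<X>.                                    *)
Definition ncpoly (F : fieldType) (X : choiceType) : lalgType F :=
  {malg F[{fmonom X}]}.

Definition ncvar (F : fieldType) (X : choiceType) (x : X) : ncpoly F X :=
  << fmu x >>.

Definition nceval (F : fieldType) (X : choiceType) (R : algType F)
    (v : X -> R) (p : ncpoly F X) : R :=
  mmap (in_alg R) (fun w : {fmonom X} => \prod_(x <- w) v x) p.

(* A is the set of elements that may be substituted for the variables; it is  *)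
(* intended to be a subalgebra of R, possibly without unit (then p should     *)
(* have no constant term).                                                    *)
Definition poly_identity (F : fieldType) (X : choiceType) (R : algType F)
    (A : {pred R}) (p : ncpoly F X) : Prop :=
  p != 0 /\ forall v : X -> R, (forall x, v x \in A) -> nceval v p = 0.

(* This is h_{2t}: the subscript is the total degree, t is half of it. The    *)
(* variable x_i is inl i and y_i is inr i.                                    *)
Definition double_capelli (F : fieldType) (t : nat) :
    ncpoly F ('I_t + 'I_t)%type :=
  \sum_(s : 'S_t) \sum_(u : 'S_t)
    ((-1) ^+ s * (-1) ^+ u) *:
      \prod_(i < t) (ncvar F (inl (s i)) * ncvar F (inr (u i))).

Lemma ncpoly_prod_vars (F : fieldType) (X : choiceType) (r : seq X) :
  \prod_(x <- r) ncvar F x = << FMonom r >>.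
Proof.
elim: r => [|x r IHr]; first by rewrite big_nil -fmoneE.
rewrite big_cons IHr malgM_def /ncvar fgmulUU mulr1 fmuE.
by congr << _ >>; exact: fmmulE.
Qed.

Lemma nceval_double_capelli (F : fieldType) (R : algType F) (t : nat)
    (a b : 'I_t -> R) :
  nceval (fun x => match x with inl i => a i | inr i => b i end)
    (double_capelli F t) =
  \sum_(s : 'S_t) \sum_(u : 'S_t)
    ((-1) ^+ s * (-1) ^+ u) *: \prod_(i < t) (a (s i) * b (u i)).
Proof.
set v := fun x => _.
rewrite /nceval /double_capelli raddf_sum; apply: eq_bigr => s _.
rewrite raddf_sum; apply: eq_bigr => u _.
pose w := flatten [seq [:: inl (s i); inr (u i)] | i <- index_enum 'I_t].
have prodw (S : nzRingType) (g : 'I_t + 'I_t -> S) :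
    \prod_(i < t) (g (inl (s i)) * g (inr (u i))) = \prod_(x <- w) g x.
  rewrite /w; elim: (index_enum _) => [|i l IHl] /=; first by rewrite !big_nil.
  by rewrite !big_cons IHl mulrA.
rewrite (prodw _ (@ncvar F _)) (prodw _ v) ncpoly_prod_vars.
rewrite -[_ *: << _ >>]mul_malgC malgM_def fgmulUU mul1m mulr1.
rewrite /= (mmapU (f := in_alg R)) /=.
by rewrite mulr_algl.
Qed.

(* Main.v *)
Require Import Defs.
From HB Require Import structures.
From mathcomp Require Import all_boot all_fingroup all_algebra all_field.
From mathcomp Require Import boolp zify finmap.
From mathcomp.multinomials Require Import monalg.

(** Over an arbitrary field the argument separates into an identity for
    block triangular matrices and a reduction of every proper subalgebra to
    that case.

    The identity rests on matrices with anticommuting entries. Let [X] and [Y]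
    be n x n matrices over a torsion-free ring, all entries of both
    anticommuting. The entries of [X Y] and [Y X] then generate a commutative
    ring, in which [tr ((X Y)^k) = - tr ((Y X)^k)] for k > 0. So the block
    diagonal matrix with blocks [X Y] and [Y X] has vanishing power traces,
    hence characteristic polynomial [T^(2n)]; that is, if p and q denote the
    characteristic polynomials of [X Y] and [Y X], then [p q = T^(2n)].
    Differentiating, [p' q + p q' = 2n T^(2n-1)]; evaluating at [X Y] and
    multiplying by [Y] on the left kills both terms by Cayley-Hamilton, because
    [Y r(X Y) = r(Y X) Y] for every polynomial r. Therefore
    [Y (X Y)^(2n-1) = 0] ([odd_alternating_power0]): alternating words of
    length 4n - 1 vanish, one letter below the bound given by [p q = T^(2n)].

    For block triangular [X] and [Y] with diagonal blocks of sizes p and q,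
    p + q = n, write [(X Y)^(2n-1)] as [(X Y)^(2q-1) X] times [Y (X Y)^(2p-1)].
    The first factor has a zero block of size q and the second a zero block of
    size p on the diagonal, and the product of two such matrices is zero
    ([lower_block_nilpotent]). Saving one letter in each of the two words is
    what brings the degree down to 4n - 2. Taking for [X] and [Y] the generic
    combinations [sum e_i a_i] and [sum f_j b_j] with Grassmann coefficients,
    [(X Y)^t] is the double Capelli sum times a product of generators that has
    no annihilator among the scalars, so that the sum is zero. Torsion is no
    obstacle, because every commutative ring is a quotient of a torsion-free
    one ([lower_block_identity]).

    A subalgebra with an invariant subspace is conjugate to one made of block
    triangular matrices. For an irreducible A the argument is an induction on
    the rank of a nonzero T in A, over all fields at once. If T has rank 1, the
    transitivity of A on rows and on columns puts all matrices of rank 1 in A,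
    so A is not proper. If T has larger rank, there is an S in A such that
    [T S T] is not a multiple of T, and the eigenvalue c of the map
    [w |-> w S T] on the row space of T, which exists over a finite extension
    of the field, makes [T S T - c T] a nonzero element of smaller rank in the
    extended algebra ([rank_drop_extension]). Under this extension a proper
    subalgebra stays proper and the double Capelli sum keeps its value, so the
    induction applies. *)

Set Implicit Arguments.
Unset Strict Implicit.
Unset Printing Implicit Defensive.

Import GRing.Theory.
Local Open Scope ring_scope.

(** * Commutative subrings generated by commuting elements *)

Section Bicommutant.
Variables (G : nzRingType) (S : G -> Prop).
Hypothesis S_comm : forall x y, S x -> S y -> GRing.comm x y.

Definition centralizes (c : G) : Prop := forall s, S s -> GRing.comm c s.

Definition bicommutant : {pred G} :=
  fun x => `[< forall c, centralizes c -> GRing.comm c x >].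

Fact bicommutant_subring : subring_closed bicommutant.
Proof.
split=> [|x y /asboolP Bx /asboolP By|x y /asboolP Bx /asboolP By];
  apply/asboolP => c cS.
- exact: commr1.
- by apply: commrB; [exact: Bx | exact: By].
- by apply: commrM; [exact: Bx | exact: By].
Qed.

HB.instance Definition _ :=
  GRing.isSubringClosed.Build G bicommutant bicommutant_subring.

Record bicommutant_type := Bicommutant {
  bicommutant_val :> G;
  bicommutant_valP : bicommutant_val \in bicommutant
}.

HB.instance Definition _ := [isSub for bicommutant_val].
HB.instance Definition _ := [Choice of bicommutant_type by <:].
HB.instance Definition _ :=
  [SubChoice_isSubNzRing of bicommutant_type by <:].

Fact bicommutant_mulC : commutative (@GRing.mul bicommutant_type).
Proof.
move=> [x Bx] [y By]; apply: val_inj; rewrite !rmorphM /=.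
move/asboolP: Bx => Bx; move/asboolP: By => By.
apply/esym/Bx => s Ss; apply/esym/By => s' Ss'; exact: S_comm.
Qed.

HB.instance Definition _ :=
  GRing.PzRing_hasCommutativeMul.Build bicommutant_type bicommutant_mulC.

(** Determinants and characteristic polynomials require a commutative ring of
    coefficients, whereas the matrices below live over a noncommutative one.
    The bicommutant of a commuting family [S] supplies it: its elements commute
    with everything that commutes with [S], in particular with [S] and hence
    with one another. *)
Lemma commuting_hull : exists (E : comNzRingType) (f : {rmorphism E -> G}),
  [/\ injective f, forall s, S s -> exists x, f x = s &
      forall c, centralizes c -> forall x, GRing.comm c (f x)].
Proof.
exists bicommutant_type, (val : {rmorphism bicommutant_type -> G}); split.
- exact: val_inj.
- move=> s Ss; have Bs : s \in bicommutant by apply/asboolP => c; apply.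
  by exists (Bicommutant Bs).
- by move=> c cS [x Bx] /=; move/asboolP: Bx; apply.
Qed.

End Bicommutant.

(** * Matrices with vanishing power traces *)

Definition torsion_free (V : zmodType) :=
  forall (x : V) (k : nat), x *+ k.+1 = 0 -> x = 0.

Lemma deriv_prod (R : comNzRingType) (I : finType) (F : I -> {poly R}) :
  (\prod_i F i)^`() = \sum_i \prod_j (if j == i then (F j)^`() else F j).
Proof.
have gen (r : seq I) : uniq r -> (\prod_(i <- r) F i)^`() =
    \sum_(i <- r) \prod_(j <- r) (if j == i then (F j)^`() else F j).
  elim: r => [|x r IHr] /=; first by rewrite !big_nil derivC.
  case/andP=> xr r_uniq; rewrite !big_cons derivM IHr // eqxx.
  congr (_ * _ + _).
    by apply: eq_big_seq => j jr; rewrite ifN //; apply: contraNneq xr => <-.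
  rewrite mulr_sumr; apply: eq_big_seq => i ir.
  by rewrite big_cons ifN //; apply: contraNneq xr => ->.
exact/gen/index_enum_uniq.
Qed.

(** Jacobi's formula: the determinant is linear in each row, so differentiating
    it means differentiating one row at a time, and the expansion along the
    differentiated row produces the adjugate. *)
Lemma deriv_det (R : comNzRingType) (n : nat) (A : 'M[{poly R}]_n) :
  (\det A)^`() = \tr (map_mx (@deriv R) A *m \adj A).
Proof.
pose B i := \matrix_(k, l) (if k == i then (A k l)^`() else A k l).
have -> : (\det A)^`() = \sum_i \det (B i).
  rewrite /determinant raddf_sum exchange_big /=; apply: eq_bigr => s _.
  rewrite -mulr_sumr derivM.
  have -> : ((-1) ^+ s : {poly R})^`() = 0.
    by case: (odd_perm s); rewrite ?expr1 ?derivN derivC ?oppr0.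
  rewrite mul0r add0r deriv_prod; congr (_ * _); apply: eq_bigr => i _.
  by apply: eq_bigr => j _; rewrite mxE; case: eqP.
apply: eq_bigr => i _; rewrite (expand_det_row _ i) mxE.
apply: eq_bigr => j _; rewrite !mxE eqxx; congr (_ * (_ * \det _)).
by apply/matrixP => k l; rewrite !mxE eq_sym (negbTE (neq_lift _ _)).
Qed.

Lemma deriv_char_poly (R : comNzRingType) (n : nat) (A : 'M[R]_n) :
  (char_poly A)^`() = \tr (\adj (char_poly_mx A)).
Proof.
rewrite /char_poly deriv_det; congr (\tr _).
rewrite -[RHS]mul1mx; congr (_ *m _); apply/matrixP => i j.
by rewrite !mxE derivD derivN derivC subr0 derivMn derivX.
Qed.

(** Newton's identities when all power sums vanish. Compare the coefficient
    matrices [B i] of the adjugate of [T - A] with the coefficients of p, the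
    characteristic polynomial: the adjugate relation gives
    [B i = p_(i+1) + A B_(i+1)], so that [tr (B i) = n p_(i+1)] when the traces
    of the powers vanish, while Jacobi's formula gives
    [tr (B i) = (i + 1) p_(i+1)]. *)
Lemma char_poly_trace0 (R : comNzRingType) (n : nat) (A : 'M[R]_n.+1) :
    torsion_free R -> (forall k, \tr (A ^+ k.+1) = 0) ->
  char_poly A = 'X^(n.+1).
Proof.
move=> tfR trA; set p := char_poly A.
pose K := \adj (char_poly_mx A).
pose B i : 'M[R]_n.+1 := map_mx (coefp i) K.
have KE : char_poly_mx A *m K = p%:M by rewrite mul_mx_adj.
have AK i : (map_mx (coefp i) (map_mx polyC A *m K)) = A * B i.
  apply/matrixP => k l; rewrite !mxE raddf_sum; apply: eq_bigr => j _.
  by rewrite !mxE /= coefCM.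
have rec i : B i = (p`_i.+1)%:M + A * B i.+1.
  have /(congr1 (map_mx (coefp i.+1))) := KE.
  rewrite /char_poly_mx mulmxBl mul_scalar_mx raddfB /= AK.
  move/eqP; rewrite subr_eq => /eqP; set u := map_mx _ _ => e.
  have -> : B i = u by apply/matrixP => k l; rewrite !mxE /= coefXM.
  by rewrite e; congr (_ + _); apply/matrixP => k l; rewrite !mxE /= coefMn.
have rec0 : 0 = (p`_0)%:M + A * B 0%N.
  have /(congr1 (map_mx (coefp 0%N))) := KE.
  rewrite /char_poly_mx mulmxBl mul_scalar_mx raddfB /= AK.
  move/eqP; rewrite subr_eq => /eqP; set u := map_mx _ _ => e.
  have -> : 0 = u by apply/matrixP => k l; rewrite !mxE /= coefXM.
  by rewrite e; congr (_ + _); apply/matrixP => k l; rewrite !mxE /= coefMn.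
(* A bound beyond which the coefficients vanish starts a downward induction. *)
have [N BN] : exists N, forall i, (N <= i)%N -> B i = 0.
  exists (\max_k \max_l size (K k l)) => i le_i; apply/matrixP => k l.
  rewrite [RHS]mxE [LHS]mxE /= nth_default //; apply: leq_trans le_i.
  apply: leq_trans (leq_bigmax (F := fun k => \max_l size (K k l)) k).
  exact: (leq_bigmax (F := fun l => size (K k l)) l).
have trAB k i : \tr (A ^+ k.+1 * B i) = 0.
  elim: (N - i)%N {-2}i (leqnn (N - i)) k => [|d IHd] {}i le_d k.
    by rewrite BN ?mulr0 ?raddf0 // -subn_eq0 -leqn0.
  rewrite rec mulrDr raddfD /= mulrA -exprSr IHd ?addr0.
    by rewrite -[A ^+ _ * _]/(_ *m _) mul_mx_scalar mxtraceZ trA mulr0.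
  by rewrite subnS -subn1 leq_subLR add1n.
have trB i : \tr (B i) = p`_i.+1 *+ n.+1.
  by rewrite rec mxtraceD mxtrace_scalar -[A]expr1 trAB addr0.
have p_i i : p`_i.+1 *+ i.+1 = p`_i.+1 *+ n.+1.
  rewrite -trB -coef_deriv deriv_char_poly /mxtrace coef_sum.
  by apply: eq_bigr => j _; rewrite [RHS]mxE.
(* The derivative says nothing on the constant coefficient; the trace of the
   relation for the coefficient of degree 0 does. *)
have p_0 : p`_0 = 0.
  apply: (tfR _ n); have /(congr1 mxtrace) := rec0.
  by rewrite raddf0 mxtraceD mxtrace_scalar -[A]expr1 trAB addr0 => <-.
have size_p : size p = n.+2 by exact: size_char_poly.
apply/polyP => -[|i]; rewrite coefXn //= eqSS.
have [-> | i_n] := eqVneq i n.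
  by have /monicP := char_poly_monic A; rewrite /lead_coef -/p size_p.
have [lt_in | lt_ni | /eqP] := ltngtP i n; last by rewrite (negbTE i_n).
  have : p`_i.+1 *+ n.+1 - p`_i.+1 *+ i.+1 = 0 by rewrite p_i subrr.
  rewrite -mulrnBr 1?ltnW // subSS -(subnSK lt_in); exact: tfR.
by rewrite nth_default // size_p.
Qed.

(** * Matrices with anticommuting entries *)

Definition anticommuting (G : nzRingType) (O : G -> Prop) :=
  forall x y, O x -> O y -> x * y = - (y * x).

(** The sign that makes the power traces of [X Y] and [Y X] cancel. *)
Lemma mxtrace_anticomm (G : nzRingType) (n : nat) (A B : 'M[G]_n) :
    (forall i j k l, A i j * B k l = - (B k l * A i j)) ->
  \tr (A *m B) = - \tr (B *m A).
Proof.
move=> AB; rewrite /mxtrace -sumrN.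
under eq_bigr do rewrite mxE; under [RHS]eq_bigr do rewrite mxE -sumrN.
rewrite exchange_big; apply: eq_bigr => i _; apply: eq_bigr => j _.
exact: AB.
Qed.

Lemma mulmx_scalar_comm (G : nzRingType) (m n : nat) (A : 'M[G]_(m, n)) c :
  (forall i j, GRing.comm (A i j) c) -> A *m c%:M = c%:M *m A.
Proof.
move=> Ac; apply/matrixP => i j; rewrite mul_scalar_mx !mxE.
rewrite (bigD1 j) //= big1 => [|k /negbTE kj]; rewrite !mxE ?kj ?mulr0 //.
by rewrite eqxx addr0 Ac.
Qed.

Lemma mulmx_exprC (R : nzRingType) (n : nat) (X Y : 'M[R]_n) k :
  X *m (Y *m X) ^+ k = (X *m Y) ^+ k *m X.
Proof.
elim: k => [|k IHk]; first by rewrite !expr0 mulmx1 mul1mx.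
by rewrite exprSr -mulmxE mulmxA IHk [in RHS]exprSr -!mulmxE !mulmxA.
Qed.

Section OddMatrices.
Variables (G : nzRingType) (O : G -> Prop).
Hypotheses (tfG : torsion_free G) (O_anti : anticommuting O).

Definition pair_product (g : G) := exists x y, [/\ O x, O y & g = x * y].

Lemma anticomm_pair x y z : O x -> O y -> O z -> x * (y * z) = y * z * x.
Proof.
move=> Ox Oy Oz; rewrite mulrA (O_anti Ox Oy) mulNr -(mulrA y x z).
by rewrite (O_anti Ox Oz) mulrN opprK mulrA.
Qed.

Lemma pair_product_comm g h :
  pair_product g -> pair_product h -> GRing.comm g h.
Proof.
move=> [x [y [Ox Oy ->]]] [z [w [Oz Ow ->]]]; rewrite /GRing.comm.
by rewrite -mulrA (anticomm_pair Oy) // mulrA (anticomm_pair Ox) // -!mulrA.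
Qed.

(** Products of two anticommuting elements commute with each other and with
    single elements, so [X Y] and [Y X] come from matrices [M] and [N] over a
    commutative ring [E]. Moving the first factor [X] of [(X Y)^k] to the end
    crosses an odd number of letters, hence the opposite traces. *)
Lemma even_products_lift (n : nat) (X Y : 'M[G]_n.+1) :
    (forall i j, O (X i j)) -> (forall i j, O (Y i j)) ->
  exists (E : comNzRingType) (f : {rmorphism E -> G}) (M N : 'M[E]_n.+1),
  [/\ torsion_free E, map_mx f M = X *m Y /\ map_mx f N = Y *m X,
      forall x c, O x -> GRing.comm x (f c) &
      forall k, \tr (M ^+ k.+1) + \tr (N ^+ k.+1) = 0].
Proof.
move=> OX OY.
have [E [f [f_inj f_im f_comm]]] := commuting_hull pair_product_comm.
have liftP (xy : G * G) : exists u, O xy.1 -> O xy.2 -> f u = xy.1 * xy.2.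
  case: (pselect (O xy.1 /\ O xy.2)) => [[O1 O2]|nO].
    have [|u fu] := f_im (xy.1 * xy.2); first by exists xy.1, xy.2.
    by exists u.
  by exists 0 => O1 O2; case: nO.
have [lift fE] := choice liftP.
pose mulE (A B : 'M[G]_n.+1) : 'M[E]_n.+1 :=
  \matrix_(i, j) \sum_k lift (A i k, B k j).
have mulEP (A B : 'M[G]_n.+1) : (forall i j, O (A i j)) ->
    (forall i j, O (B i j)) -> map_mx f (mulE A B) = A *m B.
  move=> OA OB; apply/matrixP => i j; rewrite !mxE rmorph_sum.
  by apply: eq_bigr => k _; apply: fE; [exact: OA | exact: OB].
have comm_f x c : O x -> GRing.comm x (f c).
  move=> Ox; apply: f_comm => _ [y [z [Oy Oz ->]]].
  exact: anticomm_pair.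
exists E, f, (mulE X Y), (mulE Y X).
split=> //.
- move=> x k xk; apply: f_inj; rewrite rmorph0; apply: (tfG (k := k)).
  by rewrite -rmorphMn xk rmorph0.
- by split; apply: mulEP.
move=> k; apply: f_inj; rewrite raddfD /= -!trace_map_mx !rmorphXn /= raddf0.
(* Split off the first X; the remaining factor is Y times an even matrix. *)
rewrite !mulEP // !exprS -!mulmxE -mulmxA mxtrace_anticomm.
  rewrite mulmx_exprC.
  by rewrite -mulmxA !mulmxE -exprSr -exprS addNr.
move=> i j a b; rewrite -(mulEP X Y) // -rmorphXn mxE mulr_sumr mulr_suml -sumrN.
apply: eq_bigr => l _; rewrite [map_mx _ _ _ _]mxE.
by rewrite mulrA (O_anti (x := X i j)) // mulNr -!mulrA comm_f.
Qed.

(** The block matrix with diagonal [X Y], [Y X] has characteristic polynomial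
    [T^(2n)], which gives [Y (X Y)^(2n) = 0] at once. The exponent drops to
    2n - 1 because the derivative of [T^(2n)] still lies in the ideal generated
    by the characteristic polynomials of the two blocks. The size n is
    [n.+1] in the statement. *)
Theorem odd_alternating_power0 (n : nat) (X Y : 'M[G]_n.+1) :
    (forall i j, O (X i j)) -> (forall i j, O (Y i j)) ->
  Y *m (X *m Y) ^+ (2 * n).+1 = 0.
Proof.
move=> OX OY.
have [E [f [M [N [tfE [fM fN] comm_f tr0]]]]] := even_products_lift OX OY.
pose D : 'M[E]_((n + n.+1).+1) := block_mx M 0 0 N.
have Dk k : D ^+ k = block_mx (M ^+ k) 0 0 (N ^+ k).
  elim: k => [|k IHk]; first by rewrite !expr0 -scalar_mx_block.
  rewrite !exprS IHk.
  have := mulmx_block M 0 0 N (M ^+ k) 0 0 (N ^+ k).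
  rewrite -[_ *m _]/(D * _) => ->.
  by rewrite !(mulmx0, mul0mx, addr0, add0r).
have pD : char_poly M * char_poly N = 'X^((n + n.+1).+1).
  rewrite -(char_poly_trace0 (A := D) tfE) => [|k].
    rewrite /char_poly -(det_ublock _ 0).
    rewrite -[RHS]/(\det (char_poly_mx (block_mx M 0 0 N))).
    by rewrite char_block_diag_mx.
  by rewrite Dk -(tr0 k); exact: (mxtrace_block (M ^+ k.+1) 0 0).
pose ev (C : 'M[E]_n.+1) p := map_mx f (horner_mx C p).
have Yev p : Y *m ev M p = ev N p *m Y.
  rewrite /ev; elim/poly_ind: p => [|p c IHp].
    by rewrite !rmorph0 mulmx0 mul0mx.
  rewrite !(rmorphD, rmorphM) /= !horner_mx_X !horner_mx_C mulmxDr mulmxDl.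
  rewrite -!mulmxE fM fN mulmxA IHp !mulmxA; congr (_ + _).
  by rewrite map_scalar_mx; apply: mulmx_scalar_comm => i j; apply: comm_f.
have CH (C : 'M[E]_n.+1) q : ev C (q * char_poly C) = 0.
  by rewrite /ev rmorphM /= Cayley_Hamilton mulr0 raddf0.
(* Each summand of the derivative of the product retains one factor, which
   Cayley-Hamilton kills on one side of Y or on the other. *)
have tfY : Y *m ev M ('X^(n + n.+1) *+ (n + n.+1).+1) = 0.
  have -> : 'X^(n + n.+1) *+ (n + n.+1).+1 = (char_poly M * char_poly N)^`().
    by rewrite pD derivXn.
  rewrite derivM [char_poly M * _]mulrC.
  have -> p q : ev M (p + q) = ev M p + ev M q by rewrite /ev !raddfD.
  by rewrite mulmxDr Yev !CH mul0mx mulmx0 addr0.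
have evX k : ev M 'X^k = (X *m Y) ^+ k.
  rewrite -fM -rmorphXn /ev; congr (map_mx f _).
  by rewrite rmorphXn /= horner_mx_X.
have evMn k p : ev M (p *+ k) = ev M p *+ k by rewrite /ev !raddfMn.
move: tfY; rewrite evMn evX addnS addnn -mul2n raddfMn => /matrixP tfY.
apply/matrixP => i j; rewrite [RHS]mxE; apply: tfG.
by rewrite -mulmxnE; apply: etrans (tfY i j) _; rewrite mxE.
Qed.

End OddMatrices.

(** * Block triangular matrices with anticommuting entries *)

Lemma lower_block_exp (R : nzRingType) (m n : nat) (A : 'M[R]_m)
    (C : 'M[R]_(n, m)) (B : 'M[R]_n) k :
  exists Z, (block_mx A 0 C B) ^+ k = block_mx (A ^+ k) 0 Z (B ^+ k).
Proof.
elim: k => [|k [Z IHk]]; first by exists 0; rewrite !expr0 -scalar_mx_block.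
exists (C *m A ^+ k + B *m Z); rewrite !exprS IHk -!mulmxE mulmx_block.
by rewrite !(mulmx0, mul0mx, addr0, add0r).
Qed.

(** Cut the word of length 4n - 2 into [(X Y)^(2q-1) X] and [Y (X Y)^(2p-1)].
    Both factors are block lower triangular; the first one has a zero second
    diagonal block and the second one a zero first diagonal block, so their
    product is zero whatever the off-diagonal blocks are. The sizes p and q are
    [p.+1] and [q.+1] in the statement. *)
Lemma lower_block_nilpotent (G : nzRingType) (O : G -> Prop) (p q : nat)
    (X1 Y1 : 'M[G]_p.+1) (X2 Y2 : 'M[G]_q.+1) (X3 Y3 : 'M[G]_(q.+1, p.+1)) :
    torsion_free G -> anticommuting O ->
    (forall i j, O (X1 i j)) -> (forall i j, O (Y1 i j)) ->
    (forall i j, O (X2 i j)) -> (forall i j, O (Y2 i j)) ->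
  (block_mx X1 0 X3 X2 *m block_mx Y1 0 Y3 Y2) ^+ (2 * (p.+1 + q.+1)).-1 = 0.
Proof.
move=> tfG anti OX1 OY1 OX2 OY2.
set X := block_mx X1 _ _ _; set Y := block_mx Y1 _ _ _.
have XY : X *m Y = block_mx (X1 *m Y1) 0 (X3 *m Y1 + X2 *m Y3) (X2 *m Y2).
  by rewrite mulmx_block !(mulmx0, mul0mx, addr0, add0r).
pose Z := X3 *m Y1 + X2 *m Y3.
have [Z1 XY1] := lower_block_exp (X1 *m Y1) Z (X2 *m Y2) (2 * q).+1.
have [Z2 XY2] := lower_block_exp (X1 *m Y1) Z (X2 *m Y2) (2 * p).+1.
have -> : (2 * (p.+1 + q.+1)).-1 = ((2 * q).+1 + ((2 * p).+1).+1)%N.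
  by rewrite !mulnDr !mulnS; lia.
rewrite exprD [_ ^+ (2 * p).+2]exprS -!mulmxE !mulmxA -(mulmxA _ Y).
rewrite XY XY1 XY2 !mulmx_block.
rewrite -(mulmx_exprC X2 Y2) (odd_alternating_power0 tfG anti OY2 OX2).
rewrite (odd_alternating_power0 tfG anti OX1 OY1).
by rewrite !(mulmx0, mul0mx, addr0, add0r) block_mx0.
Qed.

(** * Grassmann generators over a torsion-free ring *)

(** A new generator is adjoined by passing to 2 x 2 matrices: the old ones
    become [diag (g, - g)] and the new one is the lower elementary matrix,
    which anticommutes with all of them. Multiplying by it on the left moves
    the product of the old generators to the lower left corner, where the
    absence of annihilating scalars can be read. *)
Lemma grassmann_exists (R : comNzRingType) (m : nat) : torsion_free R ->
  exists (G : nzRingType) (f : {rmorphism R -> G}) (g : nat -> G),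
  [/\ torsion_free G, forall x r, GRing.comm x (f r),
      forall i j, g i * g j = - (g j * g i), forall i, g i * g i = 0 &
      forall r, f r * \prod_(i < m) g i = 0 -> r = 0].
Proof.
move=> tfR; elim: m => [|m [G [f [g [tfG fC gC gg top]]]]].
  exists R, idfun, (fun=> 0); split=> //= [x r||_|r]; first exact: mulrC.
  - by rewrite mul0r oppr0.
  - by rewrite mul0r.
  - by rewrite big_ord0 mulr1.
pose d (a b : G) : 'M[G]_(1 + 1) := block_mx a%:M 0 0 b%:M.
pose low (a : G) : 'M[G]_(1 + 1) := block_mx 0 0 a%:M 0.
have dM a b a' b' : d a b * d a' b' = d (a * a') (b * b').
  rewrite /d -mulmxE mulmx_block !(mulmx0, mul0mx, addr0, add0r).
  by rewrite -!scalar_mxM.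
have lowd a b c : low c * d a b = low (c * a).
  rewrite /d /low -mulmxE mulmx_block !(mulmx0, mul0mx, addr0, add0r).
  by rewrite -!scalar_mxM.
have dlow a b c : d a b * low c = low (b * c).
  rewrite /d /low -mulmxE mulmx_block !(mulmx0, mul0mx, addr0, add0r).
  by rewrite -!scalar_mxM.
have lowlow a b : low a * low b = 0.
  rewrite /low -mulmxE mulmx_block !(mulmx0, mul0mx, addr0, add0r).
  by rewrite block_mx0.
have dN a b : - d a b = d (- a) (- b).
  by rewrite /d opp_block_mx !raddfN /= !oppr0.
have lowN a : - low a = low (- a).
  by rewrite /low opp_block_mx !raddfN /= !oppr0.
pose f' : {rmorphism R -> 'M[G]_(1 + 1)} := (@scalar_mx G (1 + 1) \o f).
have f'E r : f' r = d (f r) (f r) by rewrite /f' /= scalar_mx_block.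
pose g' i := if i is j.+1 then d (g j) (- g j) else low 1.
exists 'M[G]_(1 + 1), f', g'; split.
- move=> x k /matrixP xk; apply/matrixP => i j; rewrite mxE.
  by apply: (tfG _ k); rewrite -mulmxnE xk mxE.
- by move=> x r; apply: mulmx_scalar_comm => i j; apply: fC.
- case=> [|i] [|j] /=; rewrite ?lowlow ?oppr0 // ?lowd ?dlow ?dM ?lowN ?dN.
  + by rewrite mulr1 mul1r opprK.
  + by rewrite mulr1 mul1r.
  + by rewrite !mulrNN -gC.
- case=> [|i] /=; rewrite ?lowlow // dM mulrNN !gg.
  by rewrite /d raddf0 block_mx0.
move=> r; rewrite f'E big_ord_recl -[g' ord0]/(low 1).
have [b ->] : exists b, \prod_(i < m) g' (lift ord0 i) = d (\prod_(i < m) g i) b.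
  elim/big_ind2: _ => [|x u y v [b ->] [c ->]|i _].
  - by exists 1; rewrite /d -scalar_mx_block.
  - by exists (b * c); rewrite dM.
  - by exists (- g i).
rewrite lowd dlow mul1r => /(congr1 (@dlsubmx G 1 1 1 1)).
rewrite block_mxKdl -(raddf0 scalar_mx) => /matrixP/(_ ord0 ord0).
by rewrite !mxE => /top.
Qed.

(** * The double Capelli sum as a coefficient of a power *)

Definition double_capelli_sum (R : comNzRingType) (n t : nat)
    (a b : 'I_t -> 'M[R]_n) : 'M[R]_n :=
  \sum_(s : 'S_t) \sum_(u : 'S_t)
    ((-1) ^+ s * (-1) ^+ u) *: \prod_(i < t) (a (s i) * b (u i)).

(** The products [u i j = e_i f_j] of Grassmann generators commute, and
    exchanging two row indices or two column indices changes the sign. In a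
    commutative ring the order of the factors is immaterial, which reduces the
    two permutations of the indices to the single one [s^-1 v]. *)
Section BialternatingProducts.
Variables (E : comNzRingType) (t : nat) (u : 'I_t -> 'I_t -> E).
Hypothesis u_swap : forall i j k l, u i j * u k l = - (u k j * u i l).
Hypothesis u_row : forall i j l, u i j * u i l = 0.
Hypothesis u_col : forall i j k, u i j * u k j = 0.

Lemma bialt_not_inj (f h : 'I_t -> 'I_t) :
  ~~ (injectiveb f && injectiveb h) -> \prod_k u (f k) (h k) = 0.
Proof.
rewrite negb_and => /orP[] /injectivePn[i [j ij eq_ij]];
  by rewrite (bigD1 i) //= (bigD1 j) 1?eq_sym //= mulrA eq_ij ?u_row ?u_col mul0r.
Qed.

Lemma bialt_perm1 (s : 'S_t) :
  \prod_k u k (s k) = (-1) ^+ s * \prod_k u k k.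
Proof.
have [ts -> {s}] := prod_tpermP s.
elim: ts => [|[i j] ts IHts] /=.
  move=> _; rewrite big_nil odd_perm1 mul1r.
  by apply: eq_bigr => k _; rewrite perm1.
case/andP=> ij /IHts {IHts}; rewrite big_cons /= /dpair /= in ij *.
set s := (\prod_(_ <- ts) _)%g => IHs.
rewrite odd_mul_tperm ij signr_addb -mulrA -IHs mulN1r.
rewrite (bigD1 i) //= (bigD1 j) 1?eq_sym //= !permM tpermL tpermR.
rewrite [in RHS](bigD1 i) //= [in RHS](bigD1 j) 1?eq_sym //= !mulrA.
rewrite (u_swap i) mulNr [u j _ * _]mulrC; congr (- (_ * _)).
by apply: eq_bigr => k /andP[ki kj]; rewrite permM tpermD 1?eq_sym.
Qed.

Lemma bialt_perm (s v : 'S_t) :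
  \prod_k u (s k) (v k) = (-1) ^+ s * (-1) ^+ v * \prod_k u k k.
Proof.
rewrite (reindex_inj (perm_inj (s := s^-1)%g)) /=.
under eq_bigr => k do rewrite permKV -permM.
by rewrite bialt_perm1 odd_permM odd_permV signr_addb.
Qed.

End BialternatingProducts.

(** The even-numbered generators go with the first family of variables and the
    odd-numbered ones with the second. *)
Lemma anticomm_bialt (G : nzRingType) (g : nat -> G) (t : nat) :
    (forall i j, g i * g j = - (g j * g i)) -> (forall i, g i * g i = 0) ->
  let w (f h : 'I_t -> 'I_t) := \prod_k (g (2 * f k)%N * g (2 * h k).+1) in
  (forall f h, ~~ (injectiveb f && injectiveb h) -> w f h = 0) /\
  (forall s v : 'S_t, w s v = (-1) ^+ s * (-1) ^+ v * \prod_(i < 2 * t) g i).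
Proof.
move=> gC gg w; pose O x := exists i, x = g i.
have O_anti : anticommuting O by move=> _ _ [i ->] [j ->]; apply: gC.
have [E [f [f_inj f_im _]]] := commuting_hull (pair_product_comm O_anti).
have liftP (ij : 'I_t * 'I_t) :
    exists x, f x = g (2 * ij.1)%N * g (2 * ij.2).+1.
  apply: f_im; exists (g (2 * ij.1)%N), (g (2 * ij.2).+1).
  by split=> //; eexists.
have [lift fE] := choice liftP; pose u i j := lift (i, j).
have fu i j : f (u i j) = g (2 * i)%N * g (2 * j).+1 by rewrite fE.
have gE x y z : g x * g y * g z = g z * (g x * g y).
  by apply/esym/(anticomm_pair O_anti); eexists.
have u_swap i j k l : u i j * u k l = - (u k j * u i l).
  apply: f_inj; rewrite rmorphN !rmorphM /= !fu !mulrA gE.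
  by rewrite [g (2 * i)%N * _]gC mulrN mulNr !mulrA.
have u_row i j l : u i j * u i l = 0.
  by apply: f_inj; rewrite rmorph0 !rmorphM /= !fu !mulrA gE mulrA gg !mul0r.
have u_col i j k : u i j * u k j = 0.
  apply: f_inj; rewrite rmorph0 !rmorphM /= !fu !mulrA gE.
  by rewrite -!mulrA gg !mulr0.
have wE p q : w p q = f (\prod_k u (p k) (q k)).
  by rewrite rmorph_prod; apply: eq_bigr => k _; rewrite fu.
have topE : \prod_(i < 2 * t) g i = f (\prod_k u k k).
  rewrite rmorph_prod; under [RHS]eq_bigr do rewrite fu.
  rewrite -(big_mkord xpredT g).
  rewrite -(big_mkord xpredT (fun k => g (2 * k)%N * g (2 * k).+1)).
  elim: t {w u fu u_swap u_row u_col wE liftP lift fE} => [|t IHt].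
    by rewrite muln0 !big_nil.
  by rewrite mulnS add2n !big_nat_recr //= IHt mulrA.
split=> [p q npq|s v]; first by rewrite wE bialt_not_inj ?rmorph0.
by rewrite wE bialt_perm // topE !rmorphM !rmorph_sign.
Qed.

(** Expanding a power of a sum indexes the terms by all functions, of which only
    the permutations survive. *)
Lemma expand_alternating (V : zmodType) (t : nat)
    (w : {ffun 'I_t -> 'I_t} -> {ffun 'I_t -> 'I_t} -> V) :
    (forall f h : {ffun 'I_t -> 'I_t},
       ~~ (injectiveb f && injectiveb h) -> w f h = 0) ->
  \sum_f \sum_h w f h = \sum_(s : 'S_t) \sum_(v : 'S_t) w (pval s) (pval v).
Proof.
move=> w0.
have perm_sum (F : {ffun 'I_t -> 'I_t} -> V) :
    (forall f : {ffun 'I_t -> 'I_t}, ~~ injectiveb f -> F f = 0) ->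
    \sum_f F f = \sum_(s : 'S_t) F (pval s).
  move=> F0; rewrite (bigID (fun f : {ffun 'I_t -> 'I_t} => injectiveb f)) /=.
  rewrite [X in _ + X]big1 ?addr0; last by move=> f /F0.
  rewrite (reindex (@pval _)) /=; last first.
    pose in_St := insubd (1%g : 'S_t).
    by exists in_St => /= f Uf; first apply: val_inj; apply: insubdK.
  by apply: eq_bigl => s; apply: (valP s).
rewrite perm_sum => [|f /negbTE f_inj]; last first.
  by apply: big1 => h _; rewrite w0 ?f_inj.
apply: eq_bigr => s _; apply: perm_sum => h /negbTE h_inj.
by rewrite w0 // h_inj andbF.
Qed.

(** The bridge between the polynomial and powers of matrices: since the scalars
    [f r] are central, the coefficients [e_i f_j] can be collected in front of
    each word of the expansion, where they yield the signs of the double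
    Capelli sum. *)
Lemma double_capelli_grassmann (R : comNzRingType) (G : nzRingType)
    (f : {rmorphism R -> G}) (g : nat -> G) (n t : nat)
    (a b : 'I_t -> 'M[R]_n) :
    (forall x r, GRing.comm x (f r)) ->
    (forall i j, g i * g j = - (g j * g i)) -> (forall i, g i * g i = 0) ->
  ((\sum_(i < t) (g (2 * i)%N)%:M *m map_mx f (a i)) *m
     (\sum_(i < t) (g (2 * i).+1)%:M *m map_mx f (b i))) ^+ t =
  (\prod_(i < 2 * t) g i)%:M *m map_mx f (double_capelli_sum a b).
Proof.
move=> fC gC gg; have [w0 wE] := anticomm_bialt t gC gg.
set X := \sum_i _; set Y := \sum_i _.
pose term (p q : 'I_t -> 'I_t) k : 'M[G]_n :=
  (g (2 * p k)%N * g (2 * q k).+1)%:M *m map_mx f (a (p k) *m b (q k)).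
have XY : X *m Y = \sum_(i < t) \sum_(j < t)
    (g (2 * i)%N * g (2 * j).+1)%:M *m map_mx f (a i *m b j).
  rewrite mulmx_suml; apply: eq_bigr => i _; rewrite mulmx_sumr.
  apply: eq_bigr => j _; rewrite scalar_mxM map_mxM !mulmxA; congr (_ *m _).
  rewrite -!mulmxA; congr (_ *m _); apply: mulmx_scalar_comm => k l.
  by rewrite mxE; apply/commr_sym/fC.
have termE p q : \prod_(k < t) term p q k =
    (\prod_k (g (2 * p k)%N * g (2 * q k).+1))%:M *m
      map_mx f (\prod_k (a (p k) * b (q k))).
  elim/big_ind3: _ => [|x1 x2 x3 y1 y2 y3 -> ->|k _].
  - by rewrite map_scalar_mx rmorph1 mulmx1.
  - rewrite -!mulmxE map_mxM scalar_mxM !mulmxA; congr (_ *m _).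
    rewrite -!mulmxA; congr (_ *m _); apply: mulmx_scalar_comm => k l.
    by rewrite mxE; apply/commr_sym/fC.
  - by [].
rewrite XY -[t in _ ^+ t]card_ord -prodr_const bigA_distr_bigA /=.
under eq_bigr do rewrite bigA_distr_bigA /=.
rewrite (expand_alternating (w := fun p q => \prod_k term p q k)) => [|p q npq].
  rewrite /double_capelli_sum raddf_sum mulmx_sumr; apply: eq_bigr => s _.
  rewrite raddf_sum mulmx_sumr; apply: eq_bigr => v _.
  rewrite termE /= map_mxZ rmorphM !rmorph_sign -mul_scalar_mx mulmxA -scalar_mxM.
  rewrite !pvalE wE; congr (_%:M *m _).
  by rewrite -signr_addb; apply/esym/commr_sign.
by rewrite termE w0 // raddf0 mul0mx.
Qed.

(** * The identity for block triangular matrices *)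

Section CmonomEval.
Variables (I : choiceType) (S : comNzRingType) (v : I -> S).

Definition cmonom_eval (m : {cmonom I}) : S := \prod_(i <- finsupp m) v i ^+ m i.

Lemma cmonom_evalE (d : {fset I}) (m : {cmonom I}) :
  (finsupp m `<=` d)%fset -> cmonom_eval m = \prod_(i <- d) v i ^+ m i.
Proof.
move=> le_md; rewrite /cmonom_eval (big_fset_incl _ le_md) // => i _.
by rewrite -cmE_eq0 => /eqP ->; rewrite expr0.
Qed.

Fact cmonom_eval_mmorphism : mmorphism cmonom_eval.
Proof.
split=> [x y|]; last by rewrite /cmonom_eval mdom1 big_seq_fset0.
rewrite {1}/cmonom_eval mdomD (cmonom_evalE (fsubsetUl _ (finsupp y))).
rewrite (cmonom_evalE (fsubsetUr (finsupp x) _)) -big_split /=.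
by apply: eq_bigr => i _; rewrite cmM exprD.
Qed.

HB.instance Definition _ :=
  monalg.isMultiplicative.Build {cmonom I} S cmonom_eval cmonom_eval_mmorphism.

End CmonomEval.

(** The polynomial ring over the integers with one variable for each element of
    [F]. The element 0 is lifted to 0 and not to its variable, so that
    lifting a matrix entry by entry preserves its zero blocks. *)
Lemma torsion_free_cover (F : comNzRingType) :
  exists (R : comNzRingType) (f : {rmorphism R -> F}) (lift : F -> R),
  [/\ torsion_free R, cancel lift f & lift 0 = 0].
Proof.
pose R : comNzRingType := {malg int[{cmonom F}]}.
pose f : {rmorphism R -> F} := mmap intr (cmonom_eval id).
pose x c : R := << ucm c >>.
exists R, f, (fun c => if c == 0 then 0 else x c); split; last by rewrite eqxx.
- move=> p k /eqP pk; apply/malgP => m; rewrite mcoeff0.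
  move/eqP/(congr1 (mcoeff m)): pk; rewrite mcoeffMn mcoeff0 => /eqP.
  by rewrite Num.Theory.mulrn_eq0 => /eqP.
move=> c; have [->|_] := eqVneq c 0; first by rewrite rmorph0.
rewrite /f /= mmapU /= mulr1z mul1r /cmonom_eval mdomU big_seq_fset1.
by rewrite cmUU.
Qed.

Lemma double_capelli_map (R F : comNzRingType) (f : {rmorphism R -> F}) n t
    (a b : 'I_t -> 'M[R]_n) :
  map_mx f (double_capelli_sum a b) =
  double_capelli_sum (fun i => map_mx f (a i)) (fun i => map_mx f (b i)).
Proof.
rewrite /double_capelli_sum raddf_sum; apply: eq_bigr => s _.
rewrite raddf_sum; apply: eq_bigr => u _ /=.
rewrite map_mxZ rmorphM !rmorph_sign; congr (_ *: _).
have fM : {morph @map_mx R F f n n : x y / x * y}.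
  by move=> x y; apply: map_mxM.
rewrite (big_morph _ fM (map_mx1 f n)).
by apply: eq_bigr => i _; rewrite -!mulmxE map_mxM.
Qed.

(** Attach Grassmann generators to the matrices and apply the vanishing of
    [(X Y)^t] to [X = sum e_i a_i] and [Y = sum f_j b_j]. *)
Lemma lower_block_identity_torsion_free (R : comNzRingType) (p q : nat)
    (a b : 'I_(2 * (p.+1 + q.+1)).-1 -> 'M[R]_(p.+1 + q.+1)) :
    torsion_free R ->
    (forall i, ursubmx (a i) = 0) -> (forall i, ursubmx (b i) = 0) ->
  double_capelli_sum a b = 0.
Proof.
set t := _.-1 in a b * => tfR a0 b0.
have [G [f [g [tfG fC gC gg top]]]] := grassmann_exists (2 * t) tfR.
(* An entry of X or Y involves all the generators of its family at once. *)
pose O x := exists s : seq (nat * R), x = \sum_(c <- s) g c.1 * f c.2.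
have O_anti : anticommuting O.
  move=> _ _ [r ->] [s ->]; rewrite !big_distrlr exchange_big -sumrN /=.
  apply: eq_bigr => c _; rewrite -sumrN; apply: eq_bigr => d _.
  rewrite -!mulrA [f _ * (g _ * _)]mulrA -fC [f _ * (g _ * _)]mulrA -fC.
  by rewrite -!mulrA ![g _ * (g _ * _)]mulrA gC mulNr fC.
pose comb (h : nat -> nat) (c : 'I_t -> 'M[R]_(p.+1 + q.+1)) :=
  \sum_(i < t) (g (h i))%:M *m map_mx f (c i).
have combE h c i j : comb h c i j = \sum_(k < t) g (h k) * f (c k i j).
  rewrite summxE; apply: eq_bigr => k _.
  by rewrite mul_scalar_mx !mxE.
have O_comb h c i j : O (comb h c i j).
  exists [seq (h k, c k i j) | k : 'I_t <- index_enum 'I_t].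
  by rewrite big_map combE.
have comb_block h c : (forall i, ursubmx (c i) = 0) -> comb h c =
    block_mx (ulsubmx (comb h c)) 0 (dlsubmx (comb h c)) (drsubmx (comb h c)).
  move=> c0; rewrite -[LHS]submxK; congr block_mx.
  apply/matrixP => i j; rewrite [LHS]mxE [LHS]mxE combE mxE big1 // => k _.
  have /matrixP/(_ i j) := c0 k; rewrite !mxE => ->.
  by rewrite rmorph0 mulr0.
pose X := comb (fun i => 2 * i)%N a; pose Y := comb (fun i => (2 * i).+1) b.
have XY0 : (X *m Y) ^+ t = 0.
  rewrite /X /Y (comb_block _ _ a0) (comb_block _ _ b0).
  apply: (lower_block_nilpotent _ _ tfG O_anti) => i j;
    by rewrite mxE mxE; apply: O_comb.
move: XY0; rewrite /X /Y double_capelli_grassmann // => /matrixP hab0.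
apply/matrixP => i j; rewrite [RHS]mxE; apply: top; rewrite -fC.
by have := hab0 i j; rewrite mul_scalar_mx !mxE.
Qed.

Lemma lower_block_identity (F : comNzRingType) (p q : nat)
    (a b : 'I_(2 * (p.+1 + q.+1)).-1 -> 'M[F]_(p.+1 + q.+1)) :
    (forall i, ursubmx (a i) = 0) -> (forall i, ursubmx (b i) = 0) ->
  double_capelli_sum a b = 0.
Proof.
move=> a0 b0; have [R [f [lift [tfR liftK lift0]]]] := torsion_free_cover F.
have mapK (c : 'M[F]_(p.+1 + q.+1)) : map_mx f (map_mx lift c) = c.
  by apply/matrixP => i j; rewrite !mxE liftK.
have map0 (c : 'M[F]_(p.+1 + q.+1)) :
    ursubmx c = 0 -> ursubmx (map_mx lift c) = 0.
  by rewrite -map_ursubmx => ->; apply/matrixP => i j; rewrite !mxE lift0.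
pose a' i := map_mx lift (a i); pose b' i := map_mx lift (b i).
have -> : a = (fun i => map_mx f (a' i)) by apply: funext => i; rewrite mapK.
have -> : b = (fun i => map_mx f (b' i)) by apply: funext => i; rewrite mapK.
rewrite -double_capelli_map lower_block_identity_torsion_free ?raddf0 // => i;
  by rewrite map0.
Qed.

(** * Matrices with a common invariant subspace *)

Lemma lower_block_identity_pos (F : comNzRingType) (d e t : nat)
    (a b : 'I_t -> 'M[F]_(d + e)) :
    (0 < d)%N -> (0 < e)%N -> t = (2 * (d + e)).-1 ->
    (forall i, ursubmx (a i) = 0) -> (forall i, ursubmx (b i) = 0) ->
  double_capelli_sum a b = 0.
Proof.
case: d e => [|p] [|q] // in a b * => _ _ def_t.
by rewrite def_t in a b *; apply: lower_block_identity.
Qed.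

Lemma double_capelli_conj (F : comNzRingType) (n k t : nat) (P : 'M[F]_(k, n))
    (Q : 'M[F]_(n, k)) (a b : 'I_t -> 'M[F]_n) :
    P *m Q = 1%:M -> Q *m P = 1%:M ->
  double_capelli_sum a b =
  Q *m double_capelli_sum (fun i => P *m a i *m Q) (fun i => P *m b i *m Q) *m P.
Proof.
move=> PQ QP.
have PcQ c d : P *m (c *m d) *m Q = (P *m c *m Q) *m (P *m d *m Q).
  by rewrite !mulmxA -(mulmxA (P *m c) Q P) QP mulmx1.
pose conj (c : 'M[F]_n) : 'M[F]_k := P *m c *m Q.
have -> : double_capelli_sum (fun i => P *m a i *m Q)
    (fun i => P *m b i *m Q) = conj (double_capelli_sum a b).
  rewrite /conj /double_capelli_sum mulmx_sumr mulmx_suml; apply: eq_bigr => s _.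
  rewrite mulmx_sumr mulmx_suml; apply: eq_bigr => u _ /=.
  rewrite -scalemxAr -scalemxAl; congr (_ *: _).
  have conjM : {morph conj : x y / x * y} by move=> x y; apply: PcQ.
  have conj1 : conj 1%:M = 1 by rewrite /conj mulmx1.
  rewrite -[RHS]/(conj _) (big_morph _ conjM conj1).
  by apply: eq_bigr => i _; rewrite conjM.
by rewrite /conj !mulmxA QP mul1mx -mulmxA QP mulmx1.
Qed.

(** In a basis whose first vectors span the invariant subspace [U], and whose
    remaining ones span a complement, the matrices acting on row vectors become
    block lower triangular. *)
Lemma stable_subspace_identity (F : fieldType) (n t : nat) (U : 'M[F]_n)
    (a b : 'I_t -> 'M[F]_n) :
    t = (2 * n).-1 -> U != 0 -> ~~ row_full U ->
    (forall i, stablemx U (a i)) -> (forall i, stablemx U (b i)) ->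
  double_capelli_sum a b = 0.
Proof.
move=> def_t U0 Ufull aU bU; pose P := col_mx (row_base U) (row_base U^C%MS).
have def_n : (\rank U + \rank U^C%MS)%N = n.
  by rewrite mxrank_compl subnKC ?rank_leq_col.
have P_full : row_full P.
  rewrite -sub1mx -addsmxE (adds_eqmx (eq_row_base _) (eq_row_base _)).
  by rewrite sub1mx addsmx_compl_full.
have [Q QP] := row_fullP P_full.
have P_free : row_free P by rewrite /row_free (eqP P_full) def_n.
have PQ : P *m Q = 1%:M.
  have [Q' PQ'] := row_freeP P_free.
  by rewrite -[Q]mulmx1 -PQ' (mulmxA Q) QP mul1mx.
rewrite (double_capelli_conj _ _ PQ QP).
have stable_conj c : stablemx U c -> ursubmx (P *m c *m Q) = 0.
  move=> cU; have /submxP[D Uc] : (row_base U *m c <= row_base U)%MS.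
    by rewrite eq_row_base (submx_trans _ cU) // submxMr // eq_row_base.
  have : usubmx (P *m Q) = usubmx 1%:M by rewrite PQ.
  rewrite /P !mul_col_mx col_mxKu scalar_mx_block => UQ.
  rewrite /ursubmx col_mxKu Uc -mulmxA UQ.
  by rewrite /block_mx col_mxKu mul_mx_row mulmx0 row_mxKr.
have d_gt0 : (0 < \rank U)%N by rewrite lt0n mxrank_eq0.
have e_gt0 : (0 < \rank U^C%MS)%N.
  by rewrite mxrank_compl subn_gt0 ltn_neqAle Ufull rank_leq_col.
rewrite lower_block_identity_pos ?mulmx0 ?mul0mx ?def_n // => i;
  exact: stable_conj.
Qed.

(** * Irreducible matrix algebras *)

Lemma exists_irreducible_factor (F : fieldType) (p : {poly F}) :
  (1 < size p)%N -> exists2 q, irreducible_poly q & q %| p.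
Proof.
have [k] := ubnP (size p); elim: k => // k IHk in p *.
rewrite ltnS => le_pk p_gt1.
case: (pselect (irreducible_poly p)) => [irr_p|red_p]; first by exists p.
case: (pselect (exists2 q : {poly F}, size q != 1 & (q %| p) && ~~ (q %= p))).
  case=> q q1 /andP[qp q'p]; have p0 : p != 0 by rewrite -size_poly_gt0 ltnW.
  have q_gt1 : (1 < size q)%N.
    by rewrite ltn_neqAle eq_sym q1 size_poly_gt0 (dvdpN0 qp p0).
  have [|r irr_r rq] := IHk q _ q_gt1; last first.
    by exists r => //; apply: dvdp_trans qp.
  apply: leq_trans le_pk; rewrite ltn_neqAle dvdp_leq // andbT.
  by rewrite (dvdp_size_eqp qp).
move=> no_q; case: red_p; split=> // q q1 qp; apply/negPn/negP => q'p.
by case: no_q; exists q; rewrite // qp.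
Qed.

(** Adjoining a root of an irreducible factor of the characteristic polynomial
    is a finite extension and turns that root into an eigenvalue. *)
Lemma exists_eigenvector_extension (F : fieldType) (n : nat) (A : 'M[F]_n) :
    (0 < n)%N ->
  exists (L : fieldExtType F) (c : L) (u : 'rV[L]_n),
    u *m map_mx (in_alg L) A = c *: u /\ u != 0.
Proof.
move=> n_gt0.
have [|q irr_q q_dvd] := exists_irreducible_factor (p := char_poly A).
  by rewrite size_char_poly ltnS.
have [L _ [c qc _]] := irredp_FAdjoin irr_q; exists L, c.
have /eigenvalueP[u uA u0] : eigenvalue (map_mx (in_alg L) A) c.
  rewrite eigenvalue_root_char -map_char_poly -dvdp_XsubCl.
  apply: (dvdp_trans (y := map_poly (in_alg L) q)).
    by rewrite dvdp_XsubCl.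
  by rewrite dvdp_map.
by exists u.
Qed.

Section MatrixSpaces.
Variables (F : fieldType) (n : nat) (A : {vspace 'M[F]_n.+1}).

(** The image of [A] under a linear map, encoded as a row space so that it can be
    tested for stability and for fullness. *)
Lemma vspace_image_mx (k : nat) (f : {linear 'M[F]_n.+1 -> 'rV[F]_k}) :
  exists V : 'M[F]_k, forall w, (w <= V)%MS <-> exists2 a, a \in A & w = f a.
Proof.
exists <<\matrix_(i < \dim A) f (vbasis A)`_i>>%MS => w; rewrite genmxE; split.
  case/submxP=> D ->; exists (\sum_i D 0 i *: (vbasis A)`_i).
    apply: memv_suml => i _; rewrite memvZ // vbasis_mem // mem_nth //.
    by rewrite size_tuple.
  rewrite mulmx_sum_row linear_sum; apply: eq_bigr => i _.
  by rewrite linearZ rowK.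
case=> a /coord_vbasis -> ->; rewrite linear_sum summx_sub // => i _.
rewrite linearZ scalemx_sub //.
by rewrite -(rowK (fun i : 'I_(\dim A) => f (vbasis A)`_i)) row_sub.
Qed.

Hypothesis A_mul : (A * A <= A)%VS.

Lemma mem_mulmx a b : a \in A -> b \in A -> a *m b \in A.
Proof. by move=> Aa Ab; apply: (subvP A_mul); apply: memv_mul. Qed.

Hypothesis A_irr : forall U : 'M[F]_n.+1,
  (forall a, a \in A -> stablemx U a) -> U = 0 \/ row_full U.
Hypothesis A_neq0 : exists2 a, a \in A & a != 0.

(** The orbit [v A] is a stable subspace. If it were zero, the line of [v] would
    be stable too, so it would be the whole space and [A] would be zero. *)
Lemma irreducible_orbit (v w : 'rV[F]_n.+1) :
  v != 0 -> exists2 a, a \in A & w = v *m a.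
Proof.
move=> v0; have [V VP] := vspace_image_mx (mulmx v).
have [a Aa | V0 | V_full] := A_irr (U := V); last by apply/VP/submx_full.
  apply/row_subP => i; rewrite row_mul.
  have /VP[b Ab ->] := row_sub i V.
  by rewrite -mulmxA; apply/VP; exists (b *m a) => //; apply: mem_mulmx.
have vA a : a \in A -> v *m a = 0.
  by move=> Aa; apply/eqP; rewrite -submx0 -V0; apply/VP; exists a.
have [a Aa|V'0|v_full] := A_irr (U := <<v>>%MS).
- have /submxP[D ->] : (<<v>> <= v)%MS by rewrite genmxE.
  by rewrite -mulmxA vA // mulmx0 sub0mx.
- by move: v0; rewrite -submx0 -(genmxE v) V'0 submx0 eqxx.
have [a Aa /eqP[]] := A_neq0; apply/row_matrixP => i; rewrite row0 rowE.
have := submx_full (delta_mx 0 i : 'rV_n.+1) v_full; rewrite genmxE.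
by case/submxP=> D ->; rewrite -mulmxA vA ?mulmx0.
Qed.

(** If [A x] were not the whole space, a nonzero row [v] would annihilate it;
    but [v A] consists of all rows, and [x] is not annihilated by all rows. *)
Lemma irreducible_column_orbit (x y : 'cV[F]_n.+1) :
  x != 0 -> exists2 a, a \in A & y = a *m x.
Proof.
move=> x0; have [V VP] := vspace_image_mx (trmx \o mulmxr x).
case: (boolP (row_full V)) => [V_full | V'full].
  have /VP[a Aa /(congr1 trmx)] := submx_full y^T V_full.
  by rewrite !trmxK; exists a.
have [j kj0] : exists j, col j (cokermx V) != 0.
  apply: contrapT => no_j; case/negP: V'full; rewrite -cokermx_eq0.
  apply/eqP/trmx_inj/row_matrixP => j; rewrite -tr_col trmx0 row0.
  apply: contrapT => /eqP cj; apply: no_j; exists j.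
  by rewrite -(inj_eq (@trmx_inj _ _ _)) trmx0.
pose v := (col j (cokermx V))^T.
have v0 : v != 0 by rewrite -trmx0 (inj_eq (@trmx_inj _ _ _)).
have vAx a : a \in A -> v *m a *m x = 0.
  move=> Aa; have /submxP[D Da] : ((a *m x)^T <= V)%MS by apply/VP; exists a.
  apply: trmx_inj; rewrite -mulmxA trmx_mul Da trmxK colE mulmxA.
  by rewrite -(mulmxA D) mulmx_coker mulmx0 mul0mx trmx0.
case/eqP: x0; apply/row_matrixP => i; rewrite row0 rowE.
by have [a Aa ->] := irreducible_orbit (delta_mx 0 i) v0; apply: vAx.
Qed.

(** Write [T = x y]; then [a x y b] is in [A] for all [a] and [b] in [A], and
    by the two transitivity lemmas these are all matrices of rank one. *)
Lemma irreducible_rank1_full T : T \in A -> \rank T = 1%N -> A = fullv.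
Proof.
move=> AT T1; have := mulmx_base T; move: (col_base T) (row_base T).
rewrite T1 => x y xyT.
have T0 : T != 0 by rewrite -mxrank_eq0 T1.
have x0 : x != 0 by apply: contraNneq T0 => x0; rewrite -xyT x0 mul0mx.
have y0 : y != 0 by apply: contraNneq T0 => y0; rewrite -xyT y0 mulmx0.
apply/eqP; rewrite eqEsubv subvf; apply/subvP => M _.
rewrite (matrix_sum_delta M); apply: memv_suml => i _; apply: memv_suml => j _.
apply: memvZ; rewrite -(mul_delta_mx (0 : 'I_1)).
have [a Aa ->] := irreducible_column_orbit (delta_mx i 0) x0.
have [b Ab ->] := irreducible_orbit (delta_mx 0 j) y0.
by rewrite mulmxA -(mulmxA a) xyT !mem_mulmx.
Qed.

End MatrixSpaces.

(** * Lowering the rank by extending the field *)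

Section ScalarExtension.
Variables (F : fieldType) (L : fieldExtType F) (n : nat).
Local Notation ext := (map_mx (in_alg L)).
Implicit Type A : {vspace 'M[F]_n.+1}.

Definition scalar_ext (A : {vspace 'M[F]_n.+1}) : {vspace 'M[L]_n.+1} :=
  <<[seq ext a | a <- vbasis A]>>%VS.

Lemma mem_scalar_ext A a : a \in A -> ext a \in scalar_ext A.
Proof.
move/coord_vbasis => ->; rewrite raddf_sum memv_suml // => i _ /=.
by rewrite map_mxZ memvZ // memv_span // map_f // mem_nth // size_tuple.
Qed.

Lemma scalar_ext_mul A : (A * A <= A)%VS ->
  (scalar_ext A * scalar_ext A <= scalar_ext A)%VS.
Proof.
move=> A_mul; apply/prodvP => x y /(@coord_span _ _ _ (in_tuple _)) ->.
move=> /(@coord_span _ _ _ (in_tuple _)) ->.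
rewrite mulr_suml memv_suml // => i _.
rewrite mulr_sumr memv_suml // => j _.
rewrite -scalerAl memvZ // -scalerAr memvZ //.
have basis_ext k : (k < size [seq ext a | a <- vbasis A])%N ->
    exists2 a, a \in A & [seq ext a | a <- vbasis A]`_k = ext a.
  move=> lt_k; have /mapP[a /vbasis_mem Aa ->] := mem_nth 0 lt_k; by exists a.
have [a Aa ->] := basis_ext _ (ltn_ord i).
have [b Ab ->] := basis_ext _ (ltn_ord j).
by rewrite -mulmxE -map_mxM mem_scalar_ext // mem_mulmx.
Qed.

Lemma scalar_ext_proper A : A != fullv -> scalar_ext A != fullv.
Proof.
move=> A_proper; have : (\dim A < \dim {:'M[F]_n.+1})%N.
  rewrite ltn_neqAle dimvS ?subvf // andbT; apply: contraNneq A_proper => dimA.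
  by rewrite eqEdim subvf dimA leqnn.
rewrite !dimvf /dim /= => A_small; apply: contraTneq A_small => extA.
have := dim_span [seq ext a | a <- vbasis A].
rewrite -/(scalar_ext A) extA size_map size_tuple dimvf /dim /=.
by rewrite -leqNgt.
Qed.

End ScalarExtension.

(** Choose [S] in [A] taking the first row [y1 = x1 T] of a basis of the row
    space of [T] to some [x2] such that [x2 T] is the second row. Then
    [x1 (T S T - c T) = x2 T - c y1] is nonzero for every scalar c. With c an
    eigenvalue of [w |-> w S T] on the row space of [T], the matrix
    [T S T - c T] is killed on the left by the kernel of [T] and moreover by a
    preimage under [T] of an eigenvector, so its rank is smaller. *)
Lemma rank_drop_extension (F : fieldType) (n : nat) (A : {vspace 'M[F]_n.+1}) T :
    (A * A <= A)%VS ->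
    (forall v w : 'rV[F]_n.+1, v != 0 -> exists2 a, a \in A & w = v *m a) ->
    T \in A -> (1 < \rank T)%N ->
  exists (L : fieldExtType F) (T' : 'M[L]_n.+1),
    [/\ T' \in scalar_ext L A, T' != 0 & (\rank T' < \rank T)%N].
Proof.
move=> A_mul A_trans AT T_gt1; set r := \rank T in T_gt1 *.
pose B := row_base T.
pose i0 : 'I_r := Ordinal (ltnW T_gt1); pose i1 : 'I_r := Ordinal T_gt1.
have B_free : row_free B by apply: row_base_free.
have BT : (B <= T)%MS by rewrite eq_row_base.
have [x2 Bx2] : exists x2, row i1 B = x2 *m T.
  by apply/submxP; apply: submx_trans (row_sub _ _) BT.
have [Z BZ] := submxP BT.
have y1_neq0 : row i0 B != 0.
  rewrite rowE -(mul0mx _ B) (inj_eq (row_free_inj B_free)).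
  by apply/eqP => /matrixP/(_ 0 i0) /eqP; rewrite !mxE !eqxx oner_eq0.
have [S AS x2S] := A_trans _ x2 y1_neq0.
(* N is the matrix of w |-> w S T on the row space of T in the basis B. *)
have BST : (B *m S *m T <= B)%MS by rewrite eq_row_base submxMl.
have [N BN] := submxP BST.
have [|L [c [u [uN u0]]]] := exists_eigenvector_extension N.
  exact: ltnW.
pose ext k l (M : 'M[F]_(k, l)) := map_mx (in_alg L) M.
pose T' := ext _ _ T *m (ext _ _ S *m ext _ _ T - c%:M).
have T'E : T' = ext _ _ (T *m S *m T) - c *: ext _ _ T.
  by rewrite /T' mulmxBr mul_mx_scalar /ext !map_mxM !mulmxA.
have extB_free : row_free (ext _ _ B) by rewrite /ext row_free_map.
exists L, T'; split.
- rewrite T'E rpredB ?memvZ //; last exact: mem_scalar_ext.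
  by apply: mem_scalar_ext; rewrite !mem_mulmx.
- apply: contraTneq (oner_neq0 L) => T'0; rewrite negbK.
  have : row i0 (ext _ _ Z) *m T' =
      (delta_mx 0 i1 - c *: delta_mx 0 i0) *m ext _ _ B.
    have e0 : row i0 (ext _ _ Z) *m ext _ _ T = ext _ _ (row i0 B).
      by rewrite -map_row -map_mxM -row_mul -BZ.
    have e1 :
        ext _ _ (row i0 B) *m (ext _ _ S *m ext _ _ T) = ext _ _ (row i1 B).
      by rewrite -!map_mxM mulmxA -x2S -Bx2.
    have ed k : ext _ _ (row k B) = delta_mx 0 k *m ext _ _ B.
      by rewrite -rowE /ext map_row.
    by rewrite /T' mulmxA e0 mulmxBr mul_mx_scalar e1 !ed mulmxBl scalemxAl.
  rewrite T'0 mulmx0 => /esym; rewrite -(mul0mx _ (ext _ _ B)).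
  move/(row_free_inj extB_free)/matrixP/(_ 0 i1); rewrite !mxE eqxx /=.
  by rewrite mulr0 subr0 => /eqP.
- have w0 : u *m ext _ _ B != 0.
    by rewrite -(mul0mx _ (ext _ _ B)) (inj_eq (row_free_inj extB_free)).
  have : (kermx (ext _ _ T) < kermx T')%MS.
    apply/andP; split.
      by apply/sub_kermxP; rewrite /T' mulmxA mulmx_ker mul0mx.
    apply/negP => ker_le; case/eqP: w0.
    have : (u *m ext _ _ Z <= kermx T')%MS.
      apply/sub_kermxP; rewrite /T' mulmxA -(mulmxA u) -map_mxM -BZ mulmxBr.
      rewrite mul_mx_scalar -!mulmxA -!map_mxM mulmxA BN map_mxM mulmxA uN.
      by rewrite -scalemxAl subrr.
    move=> /submx_trans/(_ ker_le)/sub_kermxP.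
    by rewrite -mulmxA -map_mxM -BZ.
  move/rank_ltmx; rewrite !mxrank_ker /ext mxrank_map => lt_ker.
  move: lt_ker (rank_leq_row T) (rank_leq_row T'); rewrite -/r; lia.
Qed.

(** The field varies in the induction on the rank [d], since each step that
    lowers the rank of [T] may enlarge the field. *)
Lemma proper_subalgebra_identity (d : nat) :
  forall (F : fieldType) (n : nat) (A : {vspace 'M[F]_n.+1}) (T : 'M[F]_n.+1),
    (A * A <= A)%VS -> A != fullv -> T \in A -> T != 0 -> (\rank T <= d)%N ->
  forall a b : 'I_(2 * n.+1 - 1) -> 'M[F]_n.+1,
    (forall i, a i \in A) -> (forall i, b i \in A) ->
  double_capelli_sum a b = 0.
Proof.
elim: d => [|d IHd] F n A T A_mul A_proper AT T0 le_Td a b Aa Ab.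
  by case/eqP: T0; apply/eqP; rewrite -mxrank_eq0 -leqn0.
case: (pselect (exists U : 'M[F]_n.+1,
  [/\ forall x, x \in A -> stablemx U x, U != 0 & ~~ row_full U])).
  case=> U [AU U0 Ufull]; apply: (stable_subspace_identity _ U0 Ufull) => [|i|i].
  - by rewrite subn1.
  - exact/AU/Aa.
  - exact/AU/Ab.
move=> no_U; have A_irr (U : 'M[F]_n.+1) :
    (forall x, x \in A -> stablemx U x) -> U = 0 \/ row_full U.
  move=> AU; case: (eqVneq U 0) => [|U0]; [by left | right].
  by apply: contrapT => /negP Ufull; case: no_U; exists U.
have A_neq0 : exists2 x, x \in A & x != 0 by exists T.
have [T1 | T_gt1] : \rank T = 1%N \/ (1 < \rank T)%N.
  by move: T0; rewrite -mxrank_eq0; case: (\rank T) => [|[|k]]; [|left|right].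
  by case/eqP: A_proper; apply: irreducible_rank1_full AT T1.
have A_trans v w := irreducible_orbit A_mul A_irr A_neq0 (v := v) w.
have [L [T' [AT' T'0 lt_T']]] := rank_drop_extension A_mul A_trans AT T_gt1.
apply: (map_mx_inj (f := in_alg L)); rewrite raddf0 double_capelli_map.
apply: (IHd L n (scalar_ext L A) T') => // [|||i|i].
- exact: scalar_ext_mul.
- exact: scalar_ext_proper.
- by rewrite -ltnS (leq_trans lt_T').
- exact: mem_scalar_ext.
- exact: mem_scalar_ext.
Qed.

(** * The double Capelli polynomial *)

(** The pair (s, u) can be recovered from the word it contributes, so no two
    terms cancel: the word of the identity permutations has coefficient 1. *)
Lemma double_capelli_neq0 (F : fieldType) (t : nat) : double_capelli F t != 0.
Proof.
pose w (s u : 'S_t) : seq ('I_t + 'I_t) :=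
  flatten [seq [:: inl (s i); inr (u i)] | i <- index_enum 'I_t].
have prod_w (s u : 'S_t) :
    \prod_(i < t) (ncvar F (inl (s i)) * ncvar F (inr (u i))) =
      << FMonom (w s u) >>.
  rewrite -ncpoly_prod_vars /w.
  elim: (index_enum _) => [|i l IHl] /=; first by rewrite !big_nil.
  by rewrite !big_cons IHl mulrA.
have w_inj s u : w s u = w 1%g 1%g -> s = 1%g /\ u = 1%g.
  move=> eq_w; suff eq_i i : s i = i /\ u i = i.
    by split; apply/permP => i; rewrite perm1; case: (eq_i i).
  have := mem_index_enum i; move: eq_w; rewrite /w.
  elim: (index_enum _) => //= j l IHl [sj uj /IHl{}IHl].
  by rewrite inE => /predU1P[-> | /IHl //]; rewrite sj uj !perm1.
have coef_w (s u : 'S_t) : (((-1) ^+ s * (-1) ^+ u) *: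
      \prod_(i < t) (ncvar F (inl (s i)) * ncvar F (inr (u i))))
        @_(FMonom (w 1%g 1%g)) = ((s == 1%g) && (u == 1%g))%:R.
  rewrite prod_w; set c := _ * _.
  have -> :
      c *: << FMonom (w s u) >> = << c *g FMonom (w s u) >> :> ncpoly F _.
    by rewrite -mul_malgC malgM_def fgmulUU mul1m mulr1.
  rewrite mcoeffU; case: eqP => [[/w_inj[s1 u1]] | neq_w].
    by rewrite /c s1 u1 odd_perm1 mulr1 !eqxx.
  rewrite mulr0n; case: eqP => //= s1; case: eqP => //= u1.
  by case: neq_w; rewrite s1 u1.
apply/eqP => /(congr1 (mcoeff (FMonom (w 1%g 1%g)))); apply/eqP.
have -> : (double_capelli F t)@_(FMonom (w 1%g 1%g)) =
    \sum_(s : 'S_t) \sum_(u : 'S_t) ((s == 1%g) && (u == 1%g))%:R.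
  rewrite /double_capelli raddf_sum; apply: eq_bigr => s _.
  by rewrite raddf_sum; apply: eq_bigr => u _; apply: coef_w.
rewrite mcoeff0 (bigD1 (1%g : 'S_t)) //= (bigD1 (1%g : 'S_t)) //= eqxx.
rewrite [X in _ + X]big1 => [|s /negbTE s1]; last by rewrite s1 big1.
by rewrite big1 ?addr0 ?oner_neq0 // => u /negbTE ->.
Qed.

(* The size n >= 1 of the matrices is written m.+1. *)
Theorem theorem2p2 (F : fieldType) (m : nat) (A : {vspace 'M[F]_m.+1})
    (A_subalg : (A * A <= A)%VS) (A_proper : A != fullv) :
  poly_identity (mem A) (double_capelli F (2 * m.+1 - 1)%N).
Proof.
split=> [|v Av]; first exact: double_capelli_neq0.
pose a i := v (inl i); pose b i := v (inr i).
have -> : v = fun x => match x with inl i => a i | inr i => b i end.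
  by apply: funext; case.
rewrite nceval_double_capelli -/(double_capelli_sum a b).
have Aa i : a i \in A by apply: Av.
have Ab i : b i \in A by apply: Av.
(* The zero algebra has no nonzero element to start the induction with. *)
have [A0 | A0] := eqVneq A 0%VS.
  have a0 i : a i = 0 by apply/eqP; rewrite -memv0 -A0.
  rewrite /double_capelli_sum big1 // => s _; rewrite big1 // => u _.
  under eq_bigr do rewrite a0 mul0r.
  have /negbTE t_neq0 : (2 * m.+1 - 1 != 0)%N by rewrite mulnS.
  by rewrite prodr_const card_ord expr0n t_neq0 scaler0.
have AT := memv_pick A.
apply: (proper_subalgebra_identity A_subalg A_proper AT _ (leqnn _)) => //.
by rewrite vpick0.
Qed.
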